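(* Let $n$ be a positive integer. If the weighted graph $G(V,E,w)$ is strictly $n$-convex, then the maximum value $\max_{v\in V}w(v)$ is attained at a vertex whose degree is less than $n$.
   Context: All graphs are finite, simple and connected (with at least one vertex). A weighted graph $G(V,E,w)$ consists of a graph with vertex set $V$ and edge set $E$ together with a weight function $w:V\to\mathbb{R}_+$, where $\mathbb{R}_+=[0,\infty)$. For a positive integer $n$, $G(V,E,w)$ is called strictly $n$-convex if for every vertex $v\in V$ having at least $n$ adjacent vertices, and for every choice of $n$ distinct vertices $v_1,\dots,v_n$ adjacent to $v$, one has $n\cdot w(v)<w(v_1)+\cdots+w(v_n)$. *)

(* Defs.v *)
From HB Require Import structures.
From mathcomp Require Import all_boot all_order all_algebra.
From mathcomp Require Import reals.

Set Implicit Arguments.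
Unset Strict Implicit.
Unset Printing Implicit Defensive.

Import Order.TTheory GRing.Theory Num.Theory.

Local Open Scope ring_scope.

Record graph := Graph {
  vertex :> finType;
  adj : rel vertex;
  adj_sym : symmetric adj;
  adj_irrefl : irreflexive adj;
  vertex_nonempty : (0 < #|vertex|)%N;
  adj_connected : forall x y : vertex, connect adj x y
}.

Definition degree (G : graph) (v : G) : nat := #|[set u | adj v u]|.

Record weighted_graph (R : realType) := WeightedGraph {
  underlying :> graph;
  weight : underlying -> R;
  weight_ge0 : forall v, 0 <= weight v
}.

Definition strictly_convex (R : realType) (n : nat) (G : weighted_graph R) : Prop :=
  forall v : G, (n <= degree v)%N ->
  forall u : 'I_n -> G, injective u -> (forall i, adj v (u i)) ->
  n%:R * weight v < \sum_(i < n) weight (u i).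

(* Main.v *)
Require Import Defs.
From HB Require Import structures.
From mathcomp Require Import all_boot all_order all_algebra.
From mathcomp Require Import reals.

(** A weight on a finite nonempty graph attains its maximum at some vertex [v].
    Weights of neighbours never exceed the weight of [v], so no [n] of them can
    sum to more than [n * weight v]; strict [n]-convexity at [v] would say that
    they do, hence [v] cannot have [n] neighbours at all.  In fact every vertex
    of maximal weight has degree less than [n]. *)

Set Implicit Arguments.
Unset Strict Implicit.
Unset Printing Implicit Defensive.

Import Order.TTheory GRing.Theory Num.Theory.

Local Open Scope ring_scope.

Lemma exists_max_weight (R : realType) (G : weighted_graph R) :
  exists v : G, forall u : G, weight u <= weight v.
Proof.
have /card_gt0P [v0 _] := vertex_nonempty G.
have [v _ vmax] := arg_maxP (@weight R G) (erefl (xpredT v0)).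
by exists v => u; apply: vmax.
Qed.

Lemma exists_distinct_neighbours (G : graph) (n : nat) (v : G) :
  (n <= degree v)%N ->
  exists2 u : 'I_n -> G, injective u & forall i, adj v (u i).
Proof.
move=> le_n_deg.
exists (fun i => enum_val (widen_ord le_n_deg i)) => [i j /enum_val_inj|i].
  by case=> /val_inj.
by have := enum_valP (widen_ord le_n_deg i); rewrite inE.
Qed.

Theorem proposition1p3 (R : realType) (n : nat) (n_gt0 : (0 < n)%N)
    (G : weighted_graph R) (G_convex : strictly_convex n G) :
  exists v : G, (degree v < n)%N /\ (forall u : G, weight u <= weight v).
Proof.
have [v vmax] := exists_max_weight G.
exists v; split=> //; rewrite ltnNge; apply/negP => le_n_deg.
have [u u_inj u_adj] := exists_distinct_neighbours le_n_deg.
have := G_convex v le_n_deg u u_inj u_adj.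
apply/negP; rewrite -leNgt.
have -> : n%:R * weight v = \sum_(i < n) weight v.
  by rewrite sumr_const card_ord mulr_natl.
by apply: ler_sum => i _; apply: vmax.
Qed.
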